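(* In a normal form influence diagram, let $\tau_k\in[0,1]$ be a meta-parameter with reference value $\tau_k^0$, all other meta-parameters being fixed at their reference values, and let $d^*$ be the optimal strategy at the reference values. For each strategy $d$ let $\alpha_d^0$ be its expected utility at the reference values and $\alpha'_{d,k}$ the slope of its expected utility as a (linear) function of $\tau_k$. Then the admissible positive change to $\tau_k$ is $$\Delta^+=\min_{d\ :\ \alpha'_{d,k}>\alpha'_{d^*,k}}\left[\frac{\alpha^0_{d^*}-\alpha^0_d}{\alpha'_{d,k}-\alpha'_{d^*,k}}\right],$$ the admissible negative change is $$\Delta^-=\max_{d\ :\ \alpha'_{d,k}<\alpha'_{d^*,k}}\left[\frac{\alpha^0_{d^*}-\alpha^0_d}{\alpha'_{d,k}-\alpha'_{d^*,k}}\right],$$ and the admissible interval of $\tau_k$ (the set of values of $\tau_k\in[0,1]$ for which $d^*$ remains optimal) is $$I_k=\left[\max\left(0,\ \tau_k^0+\Delta^-\right),\ \min\left(1,\ \tau_k^0+\Delta^+\right)\right].$$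
   Context: A normal form influence diagram has a single decision node, with no parents; its finitely many alternatives $d$ are the strategies. A strategy is optimal if it maximizes the expected utility $EU_d$ over all strategies. A meta-parameter $\tau_k\in[0,1]$ is a number on which the conditional probabilities of a single variable of the diagram depend linearly. When all other meta-parameters are kept at their reference values, the expected utility of each strategy $d$ is a linear (affine) function of $\tau_k\in[0,1]$: $EU_d(\tau_k)=\alpha_d^0+\alpha'_{d,k}(\tau_k-\tau_k^0)$, where $\tau_k^0\in[0,1]$ is the reference value. The strategy $d^*$ is optimal at $\tau_k=\tau_k^0$, i.e. $\alpha^0_{d^*}=\max_d\alpha^0_d$. The admissible positive (negative) change $\Delta^+\ge 0$ ($\Delta^-\le 0$) is the largest increase (the largest-magnitude decrease, written as a nonpositive number) of $\tau_k$ from $\tau_k^0$ for which $d^*$ stays optimal, as determined by the affine functions $EU_d$, without regard to the constraint $0\le\tau_k\le1$. Conventions: the minimum over an empty set is $+\infty$ and the maximum over an empty set is $-\infty$. *)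

(* Defs.v *)
From HB Require Import structures.
From mathcomp Require Import all_boot all_order all_algebra.
From mathcomp Require Import all_classical all_reals ereal.
From mathcomp Require Import ring lra.

Set Implicit Arguments.
Unset Strict Implicit.
Unset Printing Implicit Defensive.

Import Order.TTheory GRing.Theory Num.Theory.

Local Open Scope classical_set_scope.
Local Open Scope ring_scope.

(* The qualitative part and the utilities of a normal form influence diagram.
   The unique decision node has no parents, so a strategy is one of its finitely
   many alternatives; it is not a member of [chance], and the arcs leaving it are
   recorded by the predicates [decision_to_chance] and [decision_to_utility].
   The total utility is the sum of the utility nodes. *)
Record nf_diagram (R : realType) := NFDiagram {
  strategy : finType ;
  chance : finType ;
  state : chance -> finType ;
  parents : chance -> {set chance} ;
  decision_to_chance : pred chance ;
  utility_node : finType ;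
  utility_parents : utility_node -> {set chance} ;
  decision_to_utility : pred utility_node ;
  utility : utility_node -> strategy -> {dffun forall v, state v} -> R ;
  parents_acyclic : forall u v, u \in parents v ->
    ~~ connect (fun a b => a \in parents b) v u ;
  utility_local : forall (n : utility_node) (d d' : strategy)
      (x x' : {dffun forall v, state v}),
    (decision_to_utility n -> d = d') ->
    {in utility_parents n, forall v, x v = x' v} ->
    utility n d x = utility n d' x' }.

Definition configuration (R : realType) (D : nf_diagram R) : finType :=
  {dffun forall v : chance D, state v}.

(* [p v s d x] is the conditional probability of [v = s] given that the decision
   is [d] and that the parents of [v] have the values they have in [x]. *)
Definition cond_probs (R : realType) (D : nf_diagram R) : Type :=
  forall v : chance D, state v -> strategy D -> configuration D -> R.

Definition valid_cond_probs (R : realType) (D : nf_diagram R)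
    (p : cond_probs D) : Prop :=
  forall v : chance D,
    [/\ forall s d x, 0 <= p v s d x,
        forall d x, \sum_(s : state v) p v s d x = 1
      & forall s d d' (x x' : configuration D),
          (decision_to_chance v -> d = d') ->
          {in parents v, forall w, x w = x' w} ->
          p v s d x = p v s d' x'].

Definition expected_utility (R : realType) (D : nf_diagram R)
    (p : cond_probs D) (d : strategy D) : R :=
  \sum_(x : configuration D)
    (\prod_(v : chance D) p v (x v) d x)
      * (\sum_(n : utility_node D) utility n d x).

Definition maximizes (R : realType) (A : Type) (eu : A -> R) (dstar : A) : Prop :=
  forall d, eu d <= eu dstar.

Definition optimal (R : realType) (D : nf_diagram R)
    (p : cond_probs D) (dstar : strategy D) : Prop :=
  maximizes (expected_utility p) dstar.

Definition set_param (R : realType) (K : finType) (tau0 : {ffun K -> R})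
    (k : K) (t : R) : {ffun K -> R} :=
  [ffun j => if j == k then t else tau0 j].

(* The family [p] of conditional probabilities is indexed by the values of all
   the meta-parameters; those other than the [k]-th stay at their reference
   values [tau0]. *)
Definition meta_parameter (R : realType) (D : nf_diagram R) (K : finType)
    (p : {ffun K -> R} -> cond_probs D) (tau0 : {ffun K -> R}) (k : K) : Prop :=
  (forall t, 0 <= t <= 1 -> valid_cond_probs (p (set_param tau0 k t))) /\
  exists v : chance D,
    (forall w, w != v -> forall t, 0 <= t <= 1 ->
       forall s d x, p (set_param tau0 k t) w s d x = p tau0 w s d x) /\
    (exists a b : state v -> strategy D -> configuration D -> R,
       forall t, 0 <= t <= 1 -> forall s d x,
         p (set_param tau0 k t) v s d x = a s d x + b s d x * t).

Definition reference_eu (R : realType) (D : nf_diagram R) (K : finType)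
    (p : {ffun K -> R} -> cond_probs D) (tau0 : {ffun K -> R})
    (d : strategy D) : R :=
  expected_utility (p tau0) d.

Definition eu_line (R : realType) (A : Type) (alpha0 alpha' : A -> R) (t0 : R)
    (d : A) (t : R) : R :=
  alpha0 d + alpha' d * (t - t0).

(* Such slopes exist for a meta-parameter, by [slopes_exist]. *)
Definition slopes (R : realType) (D : nf_diagram R) (K : finType)
    (p : {ffun K -> R} -> cond_probs D) (tau0 : {ffun K -> R}) (k : K)
    (alpha' : strategy D -> R) : Prop :=
  forall d t, 0 <= t <= 1 ->
    expected_utility (p (set_param tau0 k t)) d
      = eu_line (reference_eu p tau0) alpha' (tau0 k) d t.

Definition admissible_increases (R : realType) (A : Type) (eu : A -> R -> R)
    (t0 : R) (dstar : A) : set R :=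
  [set delta | 0 <= delta /\ forall e, 0 <= e <= delta ->
     maximizes (fun d => eu d (t0 + e)) dstar].

Definition admissible_decreases (R : realType) (A : Type) (eu : A -> R -> R)
    (t0 : R) (dstar : A) : set R :=
  [set delta | delta <= 0 /\ forall e, delta <= e <= 0 ->
     maximizes (fun d => eu d (t0 + e)) dstar].

(* The largest element, with value +oo for a set that is unbounded above; the
   sets of admissible changes are never empty for an optimal strategy. *)
Definition is_admissible_positive_change (R : realType) (A : Type)
    (eu : A -> R -> R) (t0 : R) (dstar : A) (Delta : \bar R) : Prop :=
  let S := admissible_increases eu t0 dstar in
  Delta = ereal_sup (EFin @` S) /\ (Delta \is a fin_num -> S (fine Delta)).

Definition is_admissible_negative_change (R : realType) (A : Type)
    (eu : A -> R -> R) (t0 : R) (dstar : A) (Delta : \bar R) : Prop :=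
  let S := admissible_decreases eu t0 dstar in
  Delta = ereal_inf (EFin @` S) /\ (Delta \is a fin_num -> S (fine Delta)).

Definition admissible_interval (R : realType) (D : nf_diagram R) (K : finType)
    (p : {ffun K -> R} -> cond_probs D) (tau0 : {ffun K -> R}) (k : K)
    (dstar : strategy D) : set R :=
  [set t | 0 <= t <= 1 /\ optimal (p (set_param tau0 k t)) dstar].

Lemma set_param_id (R : realType) (K : finType) (tau0 : {ffun K -> R}) (k : K) :
  set_param tau0 k (tau0 k) = tau0.
Proof. by apply/ffunP => j; rewrite ffunE; case: eqP => [->|]. Qed.

Lemma slopes_exist (R : realType) (D : nf_diagram R) (K : finType)
    (p : {ffun K -> R} -> cond_probs D) (tau0 : {ffun K -> R}) (k : K) :
  0 <= tau0 k <= 1 -> meta_parameter p tau0 k ->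
  exists alpha' : strategy D -> R, slopes p tau0 k alpha'.
Proof.
move=> h0 [_ [v [hw [a [b hv]]]]].
pose rest d (x : configuration D) : R :=
  (\prod_(w : chance D | w != v) p tau0 w (x w) d x)
    * (\sum_(n : utility_node D) utility n d x).
have EUE d t : 0 <= t <= 1 -> expected_utility (p (set_param tau0 k t)) d =
    \sum_(x : configuration D) a (x v) d x * rest d x + (\sum_(x : configuration D) b (x v) d x * rest d x) * t.
  move=> ht; rewrite mulr_suml -big_split /=; apply: eq_bigr => x _.
  rewrite (bigD1 v) //= hv // /rest.
  rewrite (eq_bigr (fun w => p tau0 w (x w) d x)); last first.
    by move=> w wv; rewrite hw.
  by ring.
exists (fun d => \sum_(x : configuration D) b (x v) d x * rest d x) => d t ht.
have E0 := EUE d (tau0 k) h0; rewrite set_param_id in E0.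
rewrite /eu_line /reference_eu E0 EUE //.
by ring.
Qed.

(* Main.v *)
(** Optimality of [dstar] after a change [e] of the parameter says that
    [e * (alpha' d - alpha' dstar) <= alpha0 dstar - alpha0 d] for all [d].
    Dividing by the slope difference turns this into an upper bound on [e] when
    the difference is positive, a lower bound when it is negative, and no
    condition when it vanishes. Hence [dstar] stays optimal exactly when
    [Delta^- <= e <= Delta^+], whatever the sign of [e]. *)

Require Import Defs.
From HB Require Import structures.
From mathcomp Require Import all_boot all_order all_algebra.
From mathcomp Require Import all_classical all_reals ereal.
From mathcomp Require Import lra.

Set Implicit Arguments.
Unset Strict Implicit.
Unset Printing Implicit Defensive.

Import Order.TTheory GRing.Theory Num.Theory.

Local Open Scope classical_set_scope.
Local Open Scope ring_scope.

(** A finite [M] belongs to the set and is its maximum; for [M = +oo] the set contains arbitrarily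
    large reals. *)
Lemma ereal_sup_itv0 (R : realType) (M : \bar R) : (0 <= M)%E ->
  ereal_sup (EFin @` [set x | 0 <= x /\ (x%:E <= M)%E]) = M.
Proof.
move=> M0; apply/le_anti/andP; split.
  by apply: ge_ereal_sup => _ [x [_ xM] <-].
case: M M0 => [r r0|_|//].
  by apply: ereal_sup_ubound; exists r.
rewrite leye_eq; apply/eqP/eq_infty => r.
(* The maximum with 0 keeps the witness in the set when [r] is negative. *)
apply: le_ereal_sup_tmp; exists (Order.max 0 r)%:E.
  by exists (Order.max 0 r) => //; rewrite /= le_max lexx leey.
by rewrite lee_fin le_max lexx orbT.
Qed.

Lemma ereal_inf_itv0 (R : realType) (m : \bar R) : (m <= 0)%E ->
  ereal_inf (EFin @` [set x | x <= 0 /\ (m <= x%:E)%E]) = m.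
Proof.
move=> m0; apply/le_anti/andP; split; last first.
  by apply: le_ereal_inf_tmp => _ [x [_ mx] <-].
case: m m0 => [r r0|//|_].
  by apply: ereal_inf_lbound; exists r.
rewrite leeNy_eq; apply/eqP/eq_ninfty => r.
apply: (@le_trans _ _ (Order.min 0 r)%:E).
  apply: ereal_inf_lbound; exists (Order.min 0 r) => //.
  by rewrite /= ge_min lexx leNye.
by rewrite lee_fin ge_min lexx orbT.
Qed.

Section Lines.
Variables (R : realType) (A : finType) (alpha0 alpha' : A -> R) (t0 : R).
Variables (dstar : A) (alpha0_max : maximizes alpha0 dstar).

Let eu := eu_line alpha0 alpha' t0.
Let ratio d := (alpha0 dstar - alpha0 d) / (alpha' d - alpha' dstar).

Definition max_increase : \bar R :=
  \big[Order.min/+oo%E]_(d | alpha' d > alpha' dstar) (ratio d)%:E.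

Definition max_decrease : \bar R :=
  \big[Order.max/-oo%E]_(d | alpha' d < alpha' dstar) (ratio d)%:E.

(** Each ratio has a nonnegative numerator, since [dstar] is best at [t0], and a positive
    denominator. *)
Lemma max_increase_ge0 : (0 <= max_increase)%E.
Proof.
apply/bigmin_geP; split=> [|d hd]; first exact: leey.
by rewrite lee_fin divr_ge0 // subr_ge0 ?alpha0_max // ltW.
Qed.

Lemma max_decrease_le0 : (max_decrease <= 0)%E.
Proof.
apply/bigmax_leP; split=> [|d hd]; first exact: leNye.
by rewrite lee_fin mulr_ge0_le0 ?invr_le0 ?subr_ge0 ?subr_le0 ?alpha0_max // ltW.
Qed.

Lemma maximizes_shiftP e :
  maximizes (fun d => eu d (t0 + e)) dstar <->
  (max_decrease <= e%:E <= max_increase)%E.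
Proof.
have euE d : (eu d (t0 + e) <= eu dstar (t0 + e)) =
    (e * (alpha' d - alpha' dstar) <= alpha0 dstar - alpha0 d).
  by rewrite /eu /eu_line; apply/idP/idP; lra.
split=> [emax|/andP[/bigmax_leP[_ le_e] /bigmin_geP[_ e_le]] d].
  apply/andP; split.
    apply/bigmax_leP; split=> [|d hd]; first exact: leNye.
    (* The slope difference is negative, so dividing by it reverses the inequality. *)
    by rewrite lee_fin ler_ndivrMr ?subr_lt0 // -euE.
  apply/bigmin_geP; split=> [|d hd]; first exact: leey.
  by rewrite lee_fin ler_pdivlMr ?subr_gt0 // -euE.
rewrite euE; case: (ltgtP (alpha' d) (alpha' dstar)) => [hd|hd|->].
- by have := le_e d hd; rewrite lee_fin ler_ndivrMr ?subr_lt0.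
- by have := e_le d hd; rewrite lee_fin ler_pdivlMr ?subr_gt0.
(* Parallel lines: the condition is independent of [e] and is optimality at [t0]. *)
- by rewrite subrr mulr0 subr_ge0.
Qed.

(** Only the endpoint [e = delta] matters: the upper bound passes to smaller [e], and the lower
    bound holds for every [e >= 0] because [max_decrease <= 0]. *)
Lemma admissible_increasesE :
  admissible_increases eu t0 dstar =
  [set delta | 0 <= delta /\ (delta%:E <= max_increase)%E].
Proof.
apply/seteqP; split=> delta [delta0 h]; split=> //.
  have /h/maximizes_shiftP/andP[] // : 0 <= delta <= delta.
  by rewrite delta0 lexx.
move=> e /andP[e0 le_e]; apply/maximizes_shiftP/andP; split.
  by apply: (le_trans max_decrease_le0); rewrite lee_fin.
by apply: le_trans h; rewrite lee_fin.
Qed.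

Lemma admissible_decreasesE :
  admissible_decreases eu t0 dstar =
  [set delta | delta <= 0 /\ (max_decrease <= delta%:E)%E].
Proof.
apply/seteqP; split=> delta [delta0 h]; split=> //.
  have /h/maximizes_shiftP/andP[] // : delta <= delta <= 0.
  by rewrite delta0 lexx.
move=> e /andP[le_e e0]; apply/maximizes_shiftP/andP; split.
  by apply: (le_trans h); rewrite lee_fin.
by apply: le_trans max_increase_ge0; rewrite lee_fin.
Qed.

Lemma max_increaseP :
  is_admissible_positive_change eu t0 dstar max_increase.
Proof.
rewrite /is_admissible_positive_change admissible_increasesE.
have max0 := max_increase_ge0; split; first by rewrite ereal_sup_itv0.
(* The bound is non-strict, so a finite supremum is attained. *)
by move=> fin; split; [exact: fine_ge0 | rewrite fineK].
Qed.

Lemma max_decreaseP :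
  is_admissible_negative_change eu t0 dstar max_decrease.
Proof.
rewrite /is_admissible_negative_change admissible_decreasesE.
have max0 := max_decrease_le0; split; first by rewrite ereal_inf_itv0.
by move=> fin; split; [exact: fine_le0 | rewrite fineK].
Qed.

End Lines.

Theorem theorem2 (R : realType) (D : nf_diagram R) (K : finType)
    (p : {ffun K -> R} -> cond_probs D) (tau0 : {ffun K -> R}) (k : K)
    (htau0 : forall j, 0 <= tau0 j <= 1)
    (hmeta : meta_parameter p tau0 k)
    (dstar : strategy D) (hopt : optimal (p tau0) dstar)
    (alpha' : strategy D -> R) (hslope : slopes p tau0 k alpha') :
  let alpha0 := reference_eu p tau0 in
  let eu := eu_line alpha0 alpha' (tau0 k) in
  let ratio d := (alpha0 dstar - alpha0 d) / (alpha' d - alpha' dstar) in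
  let Dplus : \bar R :=
    \big[Order.min/+oo%E]_(d : strategy D | alpha' d > alpha' dstar) (ratio d)%:E in
  let Dminus : \bar R :=
    \big[Order.max/-oo%E]_(d : strategy D | alpha' d < alpha' dstar) (ratio d)%:E in
  [/\ is_admissible_positive_change eu (tau0 k) dstar Dplus,
      is_admissible_negative_change eu (tau0 k) dstar Dminus
    & admissible_interval p tau0 k dstar =
        [set t : R | (Order.max 0%:E ((tau0 k)%:E + Dminus) <= t%:E
                      <= Order.min 1%:E ((tau0 k)%:E + Dplus))%E] ].
Proof.
move=> alpha0 eu ratio Dplus Dminus.
split; [exact: max_increaseP | exact: max_decreaseP |].
(* The restriction to the unit interval is essential: only there does [hslope] identify the expected
   utilities with the lines. *)
have optE t : 0 <= t <= 1 ->
    (optimal (p (set_param tau0 k t)) dstar <->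
     (Dminus <= (t - tau0 k)%:E <= Dplus)%E).
  move=> ht; rewrite -[X in _ <-> X](@maximizes_shiftP _ _ _ _ (tau0 k)) //.
  rewrite addrC subrK; split=> h d.
    by have := h d; rewrite !hslope.
  by rewrite !hslope.
apply/seteqP; split=> t /=; rewrite ge_max le_min !lee_fin.
  move=> [/[dup] ht /andP[-> ->] /(optE t ht)].
  (* Since [tau0 k] is finite, it can be moved across the inequalities even if [Dminus] or [Dplus]
     is infinite. *)
  by rewrite EFinB leeBrDl // leeBlDl.
move=> /andP[/andP[t_ge0 le_t] /andP[t_le1 t_le]].
have ht : 0 <= t <= 1 by rewrite t_ge0.
by split=> //; apply/optE; rewrite // EFinB leeBrDl // leeBlDl // le_t.
Qed.
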